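(* Let $\Gamma$ be a group and $\rho:\Gamma\to\overline H$ a homomorphism. Then the following are equivalent: (1) $\rho^*[E^x_{Sull}]_b=0\in H^2_b(\Gamma;\mathbb{Z})$ (this class does not depend on $x\in X$). (2) $\rho$ lifts to a homomorphism $\widetilde\rho:\Gamma\to\widetilde H$ and $\widetilde\rho(\Gamma)$ has a fixed point in $\mathbb{R}$. (3) $\rho(\Gamma)$ fixes a point in $X$. (4) Every $\rho(\Gamma)$-orbit in $X$ is small. (5) There exists a small $\rho(\Gamma)$-orbit in $X$. (6) $\rho^*E^x_{Sull}=0$ (as a function on $\Gamma^3$) for every $x\in X$. (7) There exists $x\in X$ such that $\rho^*E^x_{Sull}=0$.
   Context: $X=\mathbb{R}/2\mathbb{Z}$ is a circle (the double cover of $\mathbb{R}/\mathbb{Z}$), with antipodal map $x=[t]\mapsto\overline{x}=[t+1]$; identify $X$ with the unit circle in $\mathbb{R}^2$ via $[t]\mapsto e^{\pi i t}$. $\overline H$ is the group of orientation-preserving homeomorphisms of $X$ which map antipodal points to antipodal points. $\widetilde H=\{\widetilde h\in\mathrm{Homeo}^+(\mathbb{R}):\widetilde h(x+1)=\widetilde h(x)+1\ \forall x\}$ is its universal covering group; the covering $\widetilde H\to\overline H$ sends $\widetilde h$ to $[t]\mapsto[\widetilde h(t)]$ (kernel: integer multiples of translation by $2$). A $k$-tuple in $X$ is positively oriented if its entries have lifts $\widetilde x_1<\dots<\widetilde x_k<\widetilde x_1+2$ in $\mathbb{R}$. A tuple in $X$ is non-degenerate if no two of its entries (in different positions) are equal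 or antipodal. Sullivan cocycle: $E_{Sull}:X^3\to\mathbb{Z}$ is the $\overline H$-invariant function defined as follows. On a non-degenerate triple $(x,y,z)$ it is $0$ if $0\in\mathbb{R}^2$ is not in the interior of the convex hull of $x,y,z$; otherwise it is $+1$ if $(x,y,z)$ is positively oriented and $-1$ if not. It is extended to degenerate triples $(x_0,x_1,x_2)$ by perturbation: treat $x_2$, then $x_1$, then $x_0$, in this order; if the point $x_j$ being treated is equal or antipodal to one of the other two (current) points, replace it by a point $x_j^+$ such that $(x_j,x_j^+,\overline{x_j})$ is positively oriented and none of the other (current) points or their antipodes lies in the positive direction between $x_j$ and $x_j^+$; otherwise leave it unchanged. The value of $E_{Sull}(x_0,x_1,x_2)$ is its value on the resulting non-degenerate triple. This is a homogeneous 2-cocycle. For $x\in X$ put $E^x_{Sull}(g_0,g_1,g_2)=E_{Sull}(g_0x,g_1x,g_2x)$ on $\overline H^3$, a bounded homogeneous cocycle, and let $[E^x_{Sull}]_b\in H^2_b(\overline H;\mathbb{Z})$ be its bounded cohomology class (bounded cohomology of discrete groups). $\rho^*E^x_{Sull}(\gamma_0,\gamma_1,\gamma_2)=E_{Sull}(\rho(\gamma_0)x,\rho(\gamma_1)x,\rho(\gamma_2)x)$. A subset of $X$ is small if it is contained in a half-open half-circle, i.e. in the image of $[a,a+1)$ or $(a,a+1]$ for some $a\in\mathbb{R}$. *)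

(* Defs.v *)
From HB Require Import structures.
From mathcomp Require Import all_boot all_order all_algebra.
From mathcomp Require Import all_classical all_reals all_analysis.
Set Implicit Arguments.
Unset Strict Implicit.
Unset Printing Implicit Defensive.
Import Order.TTheory GRing.Theory Num.Theory.
Import numFieldNormedType.Exports.
Local Open Scope classical_set_scope.
Local Open Scope quotient_scope.
Local Open Scope ring_scope.

(* Groups of homeomorphisms; the product is composition, so that a
   homomorphism into such a group is a left action. *)

Record homeo (T : topologicalType) := Homeo {
  homeo_fun :> T -> T;
  homeo_inv : T -> T;
  homeo_funK : cancel homeo_fun homeo_inv;
  homeo_invK : cancel homeo_inv homeo_fun;
  homeo_cont : continuous homeo_fun;
  homeo_inv_cont : continuous homeo_inv }.

Section HomeoGroup.
Context {T : topologicalType}.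
Implicit Types g h k : homeo T.

HB.instance Definition _ := gen_eqMixin (homeo T).
HB.instance Definition _ := gen_choiceMixin (homeo T).

Lemma homeoP g h : g =1 h -> g = h.
Proof.
case: g => f f' fK f'K fc f'c; case: h => k k' kK k'K kc k'c /= /funext fk.
subst k; have fk' : f' = k' by apply/funext => x; rewrite -{1}(k'K x) fK.
by subst k'; congr Homeo; exact: Prop_irrelevance.
Qed.

Definition homeo_one : homeo T :=
  @Homeo T id id (frefl _) (frefl _) (fun _ => cvg_id) (fun _ => cvg_id).

Definition homeo_opp g : homeo T :=
  Homeo (homeo_invK g) (homeo_funK g) (@homeo_inv_cont _ g) (@homeo_cont _ g).

Lemma homeo_comp_cont (f k : T -> T) :
  continuous f -> continuous k -> continuous (f \o k).
Proof. by move=> fc kc x; apply: continuous_comp; [exact: kc|exact: fc]. Qed.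

Definition homeo_mul g h : homeo T :=
  @Homeo T (g \o h) (homeo_inv h \o homeo_inv g)
    (can_comp (homeo_funK g) (homeo_funK h))
    (can_comp (homeo_invK h) (homeo_invK g))
    (homeo_comp_cont (@homeo_cont _ g) (@homeo_cont _ h))
    (homeo_comp_cont (@homeo_inv_cont _ h) (@homeo_inv_cont _ g)).

Lemma homeo_mulA : associative homeo_mul.
Proof. by move=> g h k; exact: homeoP. Qed.
Lemma homeo_mul1 : left_id homeo_one homeo_mul.
Proof. by move=> g; exact: homeoP. Qed.
Lemma homeo_mulr1 : right_id homeo_one homeo_mul.
Proof. by move=> g; exact: homeoP. Qed.
Lemma homeo_mulV : left_inverse homeo_one homeo_opp homeo_mul.
Proof. by move=> g; apply: homeoP => x /=; rewrite homeo_funK. Qed.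
Lemma homeo_mulrV : right_inverse homeo_one homeo_opp homeo_mul.
Proof. by move=> g; apply: homeoP => x /=; rewrite homeo_invK. Qed.

HB.instance Definition _ := isGroup.Build (homeo T)
  homeo_mulA homeo_mul1 homeo_mulr1 homeo_mulV homeo_mulrV.

End HomeoGroup.

Section Circle.
Variable R : realType.
Implicit Types s t : R.

(* s - t belongs to 2Z, so that circle below is R/2Z *)
Definition circle_eq : rel R := fun s t => (s - t) / 2 \is a Num.int.

Lemma circle_eq_refl : reflexive circle_eq.
Proof. by move=> t; rewrite /circle_eq subrr mul0r rpred0. Qed.
Lemma circle_eq_sym : symmetric circle_eq.
Proof. by move=> s t; rewrite /circle_eq -opprB mulNr rpredN. Qed.
Lemma circle_eq_trans : transitive circle_eq.
Proof.
move=> t s u st tu; rewrite /circle_eq.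
have -> : s - u = (s - t) + (t - u) by rewrite addrA subrK.
by rewrite mulrDl rpredD.
Qed.

Canonical circle_equiv :=
  EquivRel circle_eq circle_eq_refl circle_eq_sym circle_eq_trans.

Definition circle := quotient_topology {eq_quot circle_equiv}.
HB.instance Definition _ := Quotient.on circle.
HB.instance Definition _ := Topological.on circle.

Definition circle_pi : R -> circle := \pi_circle.

Lemma circle_piP s t :
  circle_pi s = circle_pi t <-> exists n : int, s = t + 2 * n%:~R.
Proof.
have -> : (circle_pi s = circle_pi t) = (s = t %[mod {eq_quot circle_equiv}]).
  by [].
split=> [/eqmodP /intrP[n nE]|[n ->]].
  by exists n; rewrite -nE mulrCA divff ?mulr1 ?pnatr_eq0// addrC subrK.
apply/eqmodP; rewrite /= /circle_eq addrAC subrr add0r mulrAC divff.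
  by rewrite mul1r; exact: intr_int.
by rewrite pnatr_eq0.
Qed.

Lemma circle_reprK (x : circle) : circle_pi (repr x) = x.
Proof. exact: reprK. Qed.

Definition antipode (x : circle) : circle := circle_pi (repr x + 1).

Lemma antipode_pi t : antipode (circle_pi t) = circle_pi (t + 1).
Proof.
have /circle_piP[n nE] := circle_reprK (circle_pi t).
by apply/circle_piP; exists n; rewrite nE addrAC.
Qed.

(* R^o makes the product a normed module over R *)
Definition plane : Type := (R^o * R^o)%type.
HB.instance Definition _ := NormedModule.on plane.

(* [t] |-> exp(i pi t), see circle_pt_pi *)
Definition circle_pt (x : circle) : plane :=
  (cos (pi * repr x), sin (pi * repr x)).

Lemma circle_pt_pi t : circle_pt (circle_pi t) = (cos (pi * t), sin (pi * t)).
Proof.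
have /circle_piP[n nE] := circle_reprK (circle_pi t).
rewrite /circle_pt nE mulrDr mulrA -[pi * 2]/(pi * 2%:R) mulr_natr.
have H (m : nat) (u : R) : (cos (u + pi *+ 2 * m%:R) = cos u) *
                     (sin (u + pi *+ 2 * m%:R) = sin u).
  by rewrite mulr_natr (periodicn (@cosD2pi R)) (periodicn (@sinD2pi R)).
case: n nE => m _; first by rewrite !H.
rewrite NegzE mulrNz mulrN.
by rewrite -[in RHS](subrK (pi *+ 2 * m.+1%:R) (pi * t)) !H.
Qed.

Definition pos_oriented (xs : seq circle) : Prop :=
  exists ts : seq R, [/\ map circle_pi ts = xs, sorted <%R ts &
    all (fun t => t < head 0 ts + 2) ts].

Definition orientation_preserving (h : circle -> circle) : Prop :=
  forall x y z,
    pos_oriented [:: h x; h y; h z] <-> pos_oriented [:: x; y; z].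

Definition Hbar_pred : {pred homeo circle} := fun h =>
  `[< orientation_preserving h /\ forall x, h (antipode x) = antipode (h x) >].

Lemma Hbar_closed : group_closed Hbar_pred.
Proof.
split=> [|g h /asboolP[go ga] /asboolP[ho ha]]; apply/asboolP; first by split.
split=> [x y z|x].
  apply: iff_trans (go _ _ _) _; apply: iff_trans (iff_sym (ho _ _ _)) _.
  by rewrite !homeo_invK.
apply: etrans (ga _); congr (homeo_fun g _); apply: (can_inj (homeo_funK h)).
by rewrite ha !homeo_invK.
Qed.

Record Hbar := MkHbar { Hbar_val :> homeo circle; _ : Hbar_val \in Hbar_pred }.
HB.instance Definition _ := [isSub for Hbar_val].
HB.instance Definition _ := [Choice of Hbar by <:].
HB.instance Definition _ :=
  SubChoice_isSubGroup.Build _ Hbar_pred Hbar Hbar_closed.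

Definition Htilde_pred : {pred homeo R} := fun h =>
  `[< {homo h : s t / s < t} /\ forall t, h (t + 1) = h t + 1 >].

Lemma Htilde_closed : group_closed Htilde_pred.
Proof.
split=> [|g h /asboolP[gm g1] /asboolP[hm h1]]; apply/asboolP; first by split.
split=> [s t st|t] /=.
  apply: gm; rewrite ltNge le_eqVlt; apply/negP => /predU1P[e|/hm].
    by move: st; rewrite -(homeo_invK h s) -e homeo_invK ltxx.
  by rewrite !homeo_invK => /(lt_trans st); rewrite ltxx.
rewrite -g1; congr (homeo_fun g _); apply: (can_inj (homeo_funK h)).
by rewrite h1 !homeo_invK.
Qed.

Record Htilde := MkHtilde {
  Htilde_val :> homeo R; _ : Htilde_val \in Htilde_pred }.
HB.instance Definition _ := [isSub for Htilde_val].
HB.instance Definition _ := [Choice of Htilde by <:].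
HB.instance Definition _ :=
  SubChoice_isSubGroup.Build _ Htilde_pred Htilde Htilde_closed.

(* h is the image of ht under the covering homomorphism H-tilde -> H-bar *)
Definition covers (ht : Htilde) (h : Hbar) : Prop :=
  forall t, h (circle_pi t) = circle_pi (ht t).

Definition small (A : set circle) : Prop :=
  exists a : R, (A `<=` circle_pi @` `[a, a + 1[) \/
                (A `<=` circle_pi @` `]a, a + 1]).

Definition convex_hull (A : set plane) : set plane :=
  smallest (@convex_set R plane) A.

Definition Esull_nondeg (x y z : circle) : int :=
  if `[< interior (convex_hull [set circle_pt x; circle_pt y; circle_pt z]) 0 >]
  then (if `[< pos_oriented [:: x; y; z] >] then 1 else -1)
  else 0.

(* x' is an admissible perturbation of x with respect to the points y and z.
   The result has to be non-degenerate, so the positive arc from x to x' which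
   avoids y, z and their antipodes includes its end point x'; their being equal
   to x itself is allowed.  Many x' qualify, and all give the same value of
   Esull_nondeg. *)
Definition is_push (x y z x' : circle) : Prop :=
  pos_oriented [:: x; x'; antipode x] /\
  forall p, p \in [:: y; antipode y; z; antipode z] ->
    ~ pos_oriented [:: x; p; x'] /\ p <> x'.

Definition push (x y z : circle) : circle :=
  if x \in [:: y; antipode y; z; antipode z] then xget x (is_push x y z) else x.

Definition Esull (x0 x1 x2 : circle) : int :=
  let y2 := push x2 x0 x1 in
  let y1 := push x1 x0 y2 in
  let y0 := push x0 y1 y2 in
  Esull_nondeg y0 y1 y2.

End Circle.

Section BoundedCohomology.
Implicit Types G H : groupType.

Definition cochain G (n : nat) : Type := ('I_n.+1 -> G) -> int.
HB.instance Definition _ G n := GRing.Zmodule.on (cochain G n).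

Definition coboundary G n (f : cochain G n) : cochain G n.+1 :=
  fun s => \sum_(i < n.+2) (-1) ^+ i * f (s \o lift i).

Definition bounded_cochain G n (f : cochain G n) : Prop :=
  (forall g s, f (fun i => g * s i)%g = f s) /\
  exists B : int, forall s, `|f s| <= B.

Definition bounded_cocycle G n (f : cochain G n) : Prop :=
  bounded_cochain f /\ coboundary f = 0.

Definition bounded_coboundary G n : cochain G n -> Prop :=
  if n is m.+1
  then fun f => exists2 b : cochain G m, bounded_cochain b & f = coboundary b
  else fun f => f = 0.

(* The class of f in H^n_b(G; Z), as the coset of f modulo the coboundaries of
   bounded cochains.  If f is not a bounded cocycle then bclass f is empty, and
   so is not an element of H^n_b(G; Z). *)
Definition bclass G n (f : cochain G n) : set (cochain G n) :=
  [set f' | [/\ bounded_cocycle f, bounded_cocycle f' &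
                bounded_coboundary (f' - f)]].

Definition pullback G H (rho : G -> H) n (f : cochain H n) : cochain G n :=
  fun s => f (rho \o s).

(* the map H^n_b(H; Z) -> H^n_b(G; Z) induced by rho, on cosets *)
Definition bpullback G H (rho : {multiplicative G -> H}) n
    (c : set (cochain H n)) : set (cochain G n) :=
  \bigcup_(f in c) bclass (pullback rho f).

End BoundedCohomology.

(* E^x as a cochain; 0, 1 and 2 are the elements of 'I_3 *)
Definition Esull_at (R : realType) (x : circle R) : cochain (Hbar R) 2 :=
  fun g => Esull (g 0 x) (g 1 x) (g 2 x).

(* Main.v *)
Require Import Defs.
From HB Require Import structures.
From mathcomp Require Import all_boot all_order all_algebra.
From mathcomp Require Import all_classical all_reals all_analysis.
From mathcomp Require Import ring lra zify.
Import Order.TTheory GRing.Theory Num.Theory.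
Import numFieldNormedType.Exports.
Local Open Scope classical_set_scope.
Local Open Scope ring_scope.

(* With winding u = floor ((u + 1) / 2), the Sullivan cocycle is
     Esull [a] [b] [c] = winding (c - a) - winding (b - a) - winding (c - b)
   for all lifts a, b, c, and winding (k t - k s) = winding (t - s) for k in
   H-tilde.  If the pullback of the cocycle at x = [s] is the coboundary of a
   bounded invariant cochain b, then winding (k s - s) = - b (1, g) selects one
   lift k of rho g for every g.  By the cocycle formula this choice
   is multiplicative; since b is bounded the lifted orbit of s is bounded, and
   its supremum is fixed.  Conversely, the orbit of any point under a group with
   a fixed point in X is small, and a small orbit has lifts with pairwise
   differences in [-1, 1[, where winding vanishes. *)

(** * Rounding to even integers, and lifts of points of the circle *)

(** [2 * winding u] is the even integer nearest to [u]; ties, which occur at odd integers, are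
    rounded up. *)
Definition winding {R : realType} (u : R) : int := Num.floor ((u + 1) / 2).

Lemma int_squeeze (R : realType) (n : int) :
  -1 < n%:~R :> R -> n%:~R < 1 :> R -> n = 0.
Proof.
move=> n1 n2.
have : ((-1)%:~R : R) < n%:~R by rewrite mulrN1z.
have : (n%:~R : R) < 1%:~R by [].
rewrite !ltr_int; lia.
Qed.

Lemma floorP (R : realType) (u : R) (n : int) :
  Num.floor u = n <-> n%:~R <= u /\ u < n%:~R + 1.
Proof.
split=> [<-|[nu un]]; last by apply: floor_def; rewrite nu intrD.
by move: (floor_itv u); rewrite intrD => /andP.
Qed.

Lemma windingP (R : realType) (u : R) (n : int) :
  winding u = n <-> 2 * n%:~R - 1 <= u /\ u < 2 * n%:~R + 1.
Proof.
apply: iff_trans (floorP _ _ _) _; split=> -[? ?]; split; lra.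
Qed.

Lemma winding_itv (R : realType) (u : R) :
  2 * (winding u)%:~R - 1 <= u /\ u < 2 * (winding u)%:~R + 1.
Proof. exact/windingP. Qed.

Lemma windingD (R : realType) (u : R) (n : int) :
  winding (u + 2 * n%:~R) = winding u + n.
Proof.
apply/windingP; rewrite intrD; have [? ?] := winding_itv _ u; split; lra.
Qed.

Lemma winding_intP (R : realType) (u : R) (n : int) :
  winding u = n <-> (2 * n - 1)%:~R <= u /\ u < (2 * n + 1)%:~R.
Proof. by rewrite intrB intrD intrM; exact: windingP. Qed.

(** The jumps of [winding] lie at odd integers, so it factors through the floor; a perturbation that
    preserves floors preserves it. *)
Lemma eq_winding (R : realType) (u v : R) :
  Num.floor u = Num.floor v -> winding u = winding v.
Proof.
move=> uv; apply/winding_intP; rewrite -floor_ge_int -floor_lt_int uv.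
by rewrite floor_ge_int floor_lt_int; exact/winding_intP.
Qed.

Lemma floorN_nonint (R : realType) (u : R) :
  u \isn't a Num.int -> Num.floor (- u) = - Num.floor u - 1.
Proof.
move=> uZ; apply/floorP; rewrite intrB intrN.
have [|uf1 uf2] := (floorP _ u (Num.floor u)).1 => //.
have uf3 : (Num.floor u)%:~R != u by rewrite -intrEfloor.
have : (Num.floor u)%:~R < u by rewrite lt_neqAle uf3.
move=> ?; split; lra.
Qed.

Lemma circle_pi_shift (R : realType) (t : R) (n : int) :
  circle_pi (t + 2 * n%:~R) = circle_pi t.
Proof. by apply/circle_piP; exists n. Qed.

Lemma circle_piE (R : realType) (x : circle R) : exists t, x = circle_pi t.
Proof. by exists (repr x); rewrite circle_reprK. Qed.

Lemma circle_pi_near_inj (R : realType) (s t : R) :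
  circle_pi s = circle_pi t -> s - t < 2 -> t - s < 2 -> s = t.
Proof.
move=> /circle_piP[n ->] st ts.
have -> : n = 0 by apply: (@int_squeeze R); lra.
by rewrite mulr0 addr0.
Qed.

(** Translating all lifts by one even integer lets the first of them be prescribed as [a]. *)
Lemma pos_oriented3P (R : realType) (a : R) (y z : circle R) :
  pos_oriented [:: circle_pi a; y; z] <->
  exists b c,
    [/\ circle_pi b = y, circle_pi c = z & [/\ a < b, b < c & c < a + 2]].
Proof.
split=> [[[|t0 [|t1 [|t2 [|? ?]]]] []] //= [t0a <- <-]|].
  rewrite !andbT => /andP[t01 t12] /and3P[_ t1u t2u].
  move/esym/circle_piP: t0a => [n an].
  exists (t1 + 2 * n%:~R), (t2 + 2 * n%:~R); rewrite !circle_pi_shift an.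
  by split => //; split; lra.
move=> [b [c [<- <- [ab bc ca]]]]; exists [:: a; b; c]; split => //=.
- by rewrite ab bc.
- by apply/and4P; split => //; lra.
Qed.

Lemma int_parity (n : int) : exists m : int, n = 2 * m \/ n = 2 * m + 1.
Proof.
exists (n %/ 2)%Z; have := divz_eq n 2.
have := modz_ge0 n (isT : (2 : int) != 0).
have := ltz_mod n (isT : (2 : int) != 0).
have : (`|2|%N : int) = 2 by [].
lia.
Qed.

Lemma circle_int_shift (R : realType) (t : R) (n : int) :
  circle_pi (t + n%:~R) = circle_pi t \/
  circle_pi (t + n%:~R) = antipode (circle_pi t).
Proof.
have [m [->|->]] := int_parity n.
- by left; rewrite intrM circle_pi_shift.
- right; rewrite antipode_pi intrD intrM [_ + 1]addrC addrA.
  exact: circle_pi_shift.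
Qed.

(** * The Sullivan cocycle in terms of lifts *)

(** The antipodal map is translation by 1, so a point and its antipode together lift to all integer
    translates of one real. Non-degeneracy thereby becomes non-integrality of differences. *)
Lemma mem_antipodesP (R : realType) (a b : R) (p : circle R) :
  p \in [:: circle_pi a; antipode (circle_pi a);
            circle_pi b; antipode (circle_pi b)] <->
  exists2 w, w \in [:: a; b] & exists n : int, p = circle_pi (w + n%:~R).
Proof.
split=> [|[w wab [n ->]]].
  rewrite !inE => /or4P[] /eqP ->; rewrite ?antipode_pi.
  - by exists a; rewrite ?mem_head //; exists 0; rewrite addr0.
  - by exists a; rewrite ?mem_head //; exists 1.
  - by exists b; rewrite ?inE ?eqxx ?orbT //; exists 0; rewrite addr0.
  - by exists b; rewrite ?inE ?eqxx ?orbT //; exists 1.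
move: wab; rewrite !inE => /orP[] /eqP ->.
  by case: (circle_int_shift _ a n) => ->; rewrite eqxx ?orbT.
by case: (circle_int_shift _ b n) => ->; rewrite eqxx ?orbT.
Qed.

(** [push] selects an unspecified admissible point, so the separation property is derived for all of
    them. *)
Lemma is_push_lift (R : realType) (c a b : R) (x : circle R) :
  is_push (circle_pi c) (circle_pi a) (circle_pi b) x ->
  exists c', [/\ x = circle_pi c', c < c' &
    forall w n, w \in [:: a; b] -> ~ (c < w + n%:~R <= c')].
Proof.
move=> [/pos_oriented3P[c' [c'' [xE acE [cc' c'c'' c''c]]]] nosep].
have {}acE : c'' = c + 1.
  move: acE; rewrite antipode_pi => /circle_pi_near_inj; apply; lra.
exists c'; split=> // w n wab /andP[cw]; rewrite le_eqVlt => /orP wc'.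
have /nosep[npos neq] : circle_pi (w + n%:~R) \in
    [:: circle_pi a; antipode (circle_pi a);
        circle_pi b; antipode (circle_pi b)].
  by apply/mem_antipodesP; exists w => //; exists n.
case: wc' => [/eqP wc'|wc']; first by apply: neq; rewrite wc'.
apply: npos; apply/pos_oriented3P; exists (w + n%:~R), c'.
by split=> //; split=> //; lra.
Qed.

Lemma is_pushI (R : realType) (c c' a b : R) :
  c < c' -> c' < c + 1 ->
  (forall w n, w \in [:: a; b] -> ~ (c < w + n%:~R <= c')) ->
  is_push (circle_pi c) (circle_pi a) (circle_pi b) (circle_pi c').
Proof.
move=> cc' c'c nosep; split.
  rewrite antipode_pi; apply/pos_oriented3P; exists c', (c + 1).
  by split=> //; split=> //; lra.
move=> p /mem_antipodesP[w wab [n ->]]; split.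
  move=> /pos_oriented3P[w' [c'' [w'E c''E [cw' w'c'' c''c]]]].
  have c''c' : c'' = c' by move: c''E => /circle_pi_near_inj; apply; lra.
  move/circle_piP: w'E => [m w'E].
  apply: (nosep w (n + 2 * m) wab); rewrite intrD intrM addrA -w'E cw' /=.
  by rewrite -c''c' ltW.
move=> /esym/circle_piP[m c'E]; apply: (nosep w (n + 2 * m) wab).
by rewrite intrD intrM addrA -c'E cc' lexx.
Qed.

Lemma exists_separation (R : realType) (c a b : R) :
  exists c', [/\ c < c', c' < c + 1 &
    forall w n, w \in [:: a; b] -> ~ (c < w + n%:~R <= c')].
Proof.
(* [gap w] is the distance from [c] to the first integer translate of [w] strictly to its right;
   half of the smaller gap stops short of both. *)
pose gap (w : R) := (Num.floor (c - w))%:~R + 1 - (c - w).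
have gap_gt0 w : 0 < gap w.
  by have [_ ?] := (floorP _ (c - w) _).1 erefl; rewrite /gap; lra.
have gap_le1 w : gap w <= 1.
  by have [? _] := (floorP _ (c - w) _).1 erefl; rewrite /gap; lra.
have gapP w n : c < w + n%:~R -> c + gap w <= w + n%:~R.
  move=> cw; have fn : Num.floor (c - w) < n by rewrite floor_lt_int; lra.
  have : (Num.floor (c - w) + 1)%:~R <= n%:~R :> R by rewrite ler_int; lia.
  rewrite /gap.
  rewrite intrD; lra.
exists (c + Num.min (gap a) (gap b) / 2).
have m0 : 0 < Num.min (gap a) (gap b) by rewrite lt_min !gap_gt0.
have ma : Num.min (gap a) (gap b) <= gap a by rewrite ge_min lexx.
have mb : Num.min (gap a) (gap b) <= gap b by rewrite ge_min lexx orbT.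
have := gap_le1 a.
split; [lra|lra|move=> w n; rewrite !inE => /orP[] /eqP -> /andP[]].
- move=> /gapP ? ?; lra.
- move=> /gapP ? ?; lra.
Qed.

(* Pushing in the positive direction does not change floors, since these are
   right-continuous. *)
Lemma push_lift (R : realType) (c a b : R) :
  exists2 c', push (circle_pi c) (circle_pi a) (circle_pi b) = circle_pi c' &
    forall w, w \in [:: a; b] ->
      c' - w \isn't a Num.int /\ Num.floor (c' - w) = Num.floor (c - w).
Proof.
rewrite /push; case: ifPn => [_|/negP nmem].
  have [c0 [cc0 c0c sep0]] := exists_separation R c a b.
  (* [c0] only shows that an admissible push exists, so that [xget] does not return its default; the
     chosen [c'] may be another point. *)
  have := @xgetI _ (circle_pi c) _ _ (is_pushI R c c0 a b cc0 c0c sep0).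
  move=> /is_push_lift[c' [-> cc' sep]]; exists c' => // w wab.
  have [f1 f2] := (floorP _ (c' - w) _).1 erefl; split.
    apply/negP => /intrP[n c'wE]; apply: (sep w n wab); rewrite -c'wE; lra.
  apply/esym/floorP; split; last lra.
  rewrite leNgt; apply/negP => cw; apply: (sep w (Num.floor (c' - w)) wab); lra.
exists c => // w wab; split => //.
apply/negP => /intrP[n cwE]; apply: nmem; apply/mem_antipodesP; exists w => //.
by exists n; rewrite -cwE; congr circle_pi; ring.
Qed.

(** * Triangles around the origin of the plane *)

Definition det2 {R : realType} (p q : plane R) : R := p.1 * q.2 - p.2 * q.1.

Lemma convex_setP (R : realType) (A : set (plane R)) :
  @convex_set R (plane R) A <->
  forall p q t, A p -> A q -> 0 <= t -> t <= 1 -> A (t *: p + (1 - t) *: q).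
Proof.
split=> [cA p q t Ap Aq t0 t1|cA p q t /set_mem Ap /set_mem Aq].
  by have /set_mem := cA p q (Itv01 t0 t1) (mem_set Ap) (mem_set Aq).
by apply/mem_set/cA.
Qed.

Lemma near0_affine_gt0 (R : realType) (a b c : R) : 0 < c ->
  \forall v \near (0 : plane R), 0 < a * v.1 + b * v.2 + c.
Proof.
move=> c0; have ab0 : 0 < `|a| + `|b| + 1 by rewrite ltr_wpDl // addr_ge0.
(* The radius e solves (|a| + |b| + 1) e = c, so the linear part stays above -c; the 1 keeps the
   denominator positive. *)
apply/nbhs_ballP; exists (c / (`|a| + `|b| + 1)) => /=; first exact: divr_gt0.
move=> -[x y] [/= bx b_y].
have {bx}: `|0 - x| < c / (`|a| + `|b| + 1) by [].
have {b_y}: `|0 - y| < c / (`|a| + `|b| + 1) by [].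
rewrite !sub0r !normrN; set e := c / _ => ye xe.
have ce : (`|a| + `|b| + 1) * e = c by rewrite /e mulrC divfK // gt_eqF.
have e0 : 0 < e by rewrite divr_gt0.
have ax : `|a * x| <= `|a| * e by rewrite normrM ler_wpM2l // ltW.
have b_y : `|b * y| <= `|b| * e by rewrite normrM ler_wpM2l // ltW.
have := ler_norm (- (a * x)); have := ler_norm (- (b * y)).
rewrite !normrN; lra.
Qed.

(* The three determinants are, up to their constant sum, the barycentric
   coordinates of 0; they remain positive at points close to 0. *)
Lemma interior_triangle (R : realType) (p q r : plane R) :
  0 < det2 p q -> 0 < det2 q r -> 0 < det2 r p ->
  interior (convex_hull [set p; q; r]) 0.
Proof.
move=> pq qr rp.
have near_det (u w : plane R) : 0 < det2 u w ->
    \forall v \near (0 : plane R), 0 < det2 (u - v) (w - v).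
  move=> uw; apply: filterS (near0_affine_gt0 _ (u.2 - w.2) (w.1 - u.1) _ uw).
  move=> v; rewrite /det2 /=.
  by congr (0 < _); ring.
apply: filterS (filterI (near_det _ _ pq)
  (filterI (near_det _ _ qr) (near_det _ _ rp))) => v [/= + [/= + /=]].
set C := det2 (p - v) (q - v); set A := det2 (q - v) (r - v).
set B := det2 (r - v) (p - v) => C0 A0 B0.
have BC0 : 0 < B + C by rewrite addr_gt0.
have ABC0 : 0 < A + (B + C) by rewrite addr_gt0.
move=> M [/convex_setP cM sM].
have Mp : M p by apply: sM; left; left.
have Mq : M q by apply: sM; left; right.
have Mr : M r by apply: sM; right.
have le_div (x y : R) : 0 < x -> 0 < y -> 0 <= x / (x + y) <= 1.
  move=> x0 y0; have xy0 : 0 < x + y by rewrite addr_gt0.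
  by rewrite ler_pdivrMr // mul1r lerDl (ltW y0) divr_ge0 // ltW.
have /andP[l0 l1] := le_div A (B + C) A0 BC0.
have /andP[m0 m1] := le_div B C B0 C0.
(* The barycentric coordinates are nested, since convexity combines two points at a time. *)
have vE : v = (A / (A + (B + C))) *: p + (1 - A / (A + (B + C))) *:
    ((B / (B + C)) *: q + (1 - B / (B + C)) *: r).
  rewrite /C /A /B /det2 in BC0 ABC0 *.
  clear - BC0 ABC0; move: p q r v BC0 ABC0.
  move=> [p1 p2] [q1 q2] [r1 r2] [v1 v2] /= BC0 ABC0.
  by congr pair; rewrite /= /GRing.scale /=; field; rewrite !gt_eqF.
by rewrite vE; apply: (cM) => //; exact: cM.
Qed.

(** The hull stays in the closed half-plane to the left of [u], whereas every ball around 0 contains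
    a point strictly to the right of [u]. *)
Lemma not_interior_halfplane (R : realType) (u p q r : plane R) : u != 0 ->
  0 <= det2 u p -> 0 <= det2 u q -> 0 <= det2 u r ->
  ~ interior (convex_hull [set p; q; r]) 0.
Proof.
move=> u0 up uq ur.
pose H := [set v : plane R | 0 <= det2 u v].
have hullH : convex_hull [set p; q; r] `<=` H.
  apply: smallest_sub; last by move=> v [[->|->]|->].
  apply/convex_setP => v w t; rewrite /H /det2 /= => v0 w0 t0 t1.
  rewrite [leRHS](_ : _ = t * (u.1 * v.2 - u.2 * v.1) +
    (1 - t) * (u.1 * w.2 - u.2 * w.1)); last by rewrite /GRing.scale /=; ring.
  by rewrite addr_ge0 // mulr_ge0 // subr_ge0.
move=> /(filterS hullH) /nbhs_ballP[e /= e0 ballH].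
have uu : 0 < u.1 ^+ 2 + u.2 ^+ 2.
  rewrite lt_neqAle addr_ge0 ?sqr_ge0 // andbT eq_sym paddr_eq0 ?sqr_ge0 //.
  rewrite !sqrf_eq0; apply: contra u0 => /andP[/eqP a /eqP b].
  by apply/eqP; case: u a b {up uq ur H hullH ballH} => a b /= -> ->.
have n0 : 0 < `|u.1| + `|u.2| + 1 by rewrite ltr_wpDl // addr_ge0.
pose d := e / (`|u.1| + `|u.2| + 1).
have d0 : 0 < d by rewrite divr_gt0.
have de : d * `|u.1| + d * `|u.2| + d = e.
  by rewrite -[d in _ + d]mulr1 -!mulrDr /d divfK // gt_eqF.
have d1 : 0 <= d * `|u.1| by rewrite mulr_ge0 // ltW.
have d2 : 0 <= d * `|u.2| by rewrite mulr_ge0 // ltW.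
(* This point is [u] turned clockwise by a right angle and scaled by [d], where [det2 u] takes the
   value -d |u|^2. *)
have /ballH : ball (0 : plane R) e ((d * u.2, - (d * u.1)) : plane R).
  split=> /=.
    change (`|0 - d * u.2| < e).
    rewrite sub0r normrN normrM gtr0_norm //; lra.
  change (`|0 - - (d * u.1)| < e).
  rewrite sub0r opprK normrM gtr0_norm //; lra.
rewrite /H /det2 /= => abs.
have := mulr_gt0 d0 uu; lra.
Qed.

Lemma det2_circle_pt (R : realType) (s t : R) :
  det2 (circle_pt (circle_pi s)) (circle_pt (circle_pi t)) = sin (pi * (t - s)).
Proof. by rewrite !circle_pt_pi /det2 /= mulrBr sinB; ring. Qed.

Lemma det2_circle_pt_gt0 (R : realType) (s t : R) : s < t -> t < s + 1 ->
  0 < det2 (circle_pt (circle_pi s)) (circle_pt (circle_pi t)).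
Proof.
move=> st ts; rewrite det2_circle_pt sin_gt0_pi //.
rewrite mulr_gt0 ?pi_gt0 ?subr_gt0 //= -[ltRHS]mulr1 ltr_pM2l ?pi_gt0 //; lra.
Qed.

Lemma det2_circle_pt_ge0 (R : realType) (s t : R) : s <= t -> t <= s + 1 ->
  0 <= det2 (circle_pt (circle_pi s)) (circle_pt (circle_pi t)).
Proof.
move=> st ts; rewrite det2_circle_pt sin_ge0_pi //.
rewrite mulr_ge0 ?pi_ge0 ?subr_ge0 //= -[leRHS]mulr1 ler_pM2l ?pi_gt0 //; lra.
Qed.

Lemma circle_pt_neq0 (R : realType) (x : circle R) : circle_pt x != 0.
Proof.
apply/eqP => -[c0 s0]; have := cos2Dsin2 (pi * repr x).
by rewrite c0 s0 !expr0n addr0 => /eqP; rewrite eq_sym oner_eq0.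
Qed.

(** The line through 0 and the point over [t] leaves the whole triangle on one closed side. *)
Lemma Esull_nondeg_half (R : realType) (t a b c : R) :
  t <= a <= t + 1 -> t <= b <= t + 1 -> t <= c <= t + 1 ->
  Esull_nondeg (circle_pi a) (circle_pi b) (circle_pi c) = 0.
Proof.
move=> /andP[? ?] /andP[? ?] /andP[? ?]; rewrite /Esull_nondeg asboolF //.
apply: (@not_interior_halfplane _ (circle_pt (circle_pi t)));
  [exact: circle_pt_neq0 | exact: det2_circle_pt_ge0..].
Qed.

(** All three gaps, including the one from [c] to [a + 2], lie in ]0, 1[, so the determinants of
    consecutive points are sines of angles in ]0, pi[ and 0 is interior. *)
Lemma Esull_nondeg_pos (R : realType) (a b c : R) :
  a < b < a + 1 -> b < c < b + 1 -> c < a + 2 < c + 1 ->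
  Esull_nondeg (circle_pi a) (circle_pi b) (circle_pi c) = 1.
Proof.
move=> /andP[? ?] /andP[? ?] /andP[? ?]; rewrite /Esull_nondeg !asboolT //.
  by apply/pos_oriented3P; exists b, c.
apply: interior_triangle; [exact: det2_circle_pt_gt0..|].
by rewrite -[circle_pi a](circle_pi_shift _ _ 1) mulr1 det2_circle_pt_gt0.
Qed.

Lemma Esull_nondeg_neg (R : realType) (a b c : R) :
  b < a < b + 1 -> c < b < c + 1 -> a < c + 2 < a + 1 ->
  Esull_nondeg (circle_pi a) (circle_pi b) (circle_pi c) = -1.
Proof.
move=> /andP[? ?] /andP[? ?] /andP[? ?].
have hull0 : interior (convex_hull [set circle_pt (circle_pi a);
    circle_pt (circle_pi b); circle_pt (circle_pi c)]) 0.
  have -> (p q r : plane R) : [set p; q; r] = [set r; q; p].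
    by rewrite setUC [[set p] `|` _]setUC setUA.
  apply: interior_triangle; [exact: det2_circle_pt_gt0..|].
  by rewrite -[circle_pi c](circle_pi_shift _ _ 1) mulr1 det2_circle_pt_gt0.
rewrite /Esull_nondeg asboolT // asboolF //.
(* Positively ordered lifts starting at [a] would have to continue with [b + 2] and [c + 2], which
   are in the wrong order. *)
move=> /pos_oriented3P[b' [c' [b'E c'E [? ? ?]]]].
have b'b : b' = b + 2.
  apply: circle_pi_near_inj; [|lra|lra].
  by rewrite b'E -[LHS](circle_pi_shift _ _ 1) mulr1.
have c'c : c' = c + 2.
  apply: circle_pi_near_inj; [|lra|lra].
  by rewrite c'E -[LHS](circle_pi_shift _ _ 1) mulr1.
lra.
Qed.

Lemma winding_eq0 (R : realType) (u : R) : -1 <= u -> u < 1 -> winding u = 0.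
Proof. by move=> ? ?; apply/windingP; rewrite mulr0 !add0r. Qed.

Lemma nonint_neq (R : realType) (u : R) (n : int) :
  u \isn't a Num.int -> u != n%:~R.
Proof. by apply: contra => /eqP ->; exact: intr_int. Qed.

(** If [u] and [v] have opposite signs or |u + v| < 1, the three lifts fit in an interval of length
    1. Otherwise the triangle surrounds 0, in the direction given by the common sign. *)
Lemma Esull_nondeg_near (R : realType) (a u v : R) :
  -1 < u < 1 -> -1 < v < 1 -> u \isn't a Num.int -> v \isn't a Num.int ->
  u + v \isn't a Num.int ->
  Esull_nondeg (circle_pi a) (circle_pi (a + u)) (circle_pi (a + u + v)) =
  winding (u + v).
Proof.
move=> /andP[u1 u2] /andP[v1 v2] /(nonint_neq _ _ 0) u0 /(nonint_neq _ _ 0) v0.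
move=> uvZ; have := nonint_neq _ _ 0 uvZ; have := nonint_neq _ _ 1 uvZ.
have := nonint_neq _ _ (-1) uvZ; rewrite mulrN1z => w3 w2 w1.
case: (ltrgtP u 0) u0 => // u0 _; case: (ltrgtP v 0) v0 => // v0 _.
- case: (ltrgtP (u + v) (-1)) w3 => // w3 _.
  + rewrite Esull_nondeg_neg; try (apply/andP; split; lra).
    by apply/esym/windingP; rewrite mulrN1z; split; lra.
  + rewrite (Esull_nondeg_half _ (a + u + v)); try (apply/andP; split; lra).
    by rewrite winding_eq0 //; lra.
- rewrite (Esull_nondeg_half _ (a + u)); try (apply/andP; split; lra).
  by rewrite winding_eq0 //; lra.
- rewrite winding_eq0; [|lra..].
  case: (ltrgtP (u + v) 0) w1 => // w1 _.
  + rewrite (Esull_nondeg_half _ (a + u + v)) //; apply/andP; split; lra.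
  + rewrite (Esull_nondeg_half _ a) //; apply/andP; split; lra.
- case: (ltrgtP (u + v) 1) w2 => // w2 _.
  + rewrite (Esull_nondeg_half _ a); try (apply/andP; split; lra).
    by rewrite winding_eq0 //; lra.
  + rewrite Esull_nondeg_pos; try (apply/andP; split; lra).
    by apply/esym/windingP; split; lra.
Qed.

Lemma nonintD (R : realType) (u : R) (n : int) :
  u \isn't a Num.int -> u + n%:~R \isn't a Num.int.
Proof.
apply: contra => uZ; rewrite -[u](addrK n%:~R).
by apply: rpredB => //; exact: intr_int.
Qed.

(** Even translations of [b] and [c] reduce both increments to ]-1, 1[, where the ends are excluded
    by non-integrality; [windingD] then accounts for the translations. *)
Lemma Esull_nondegE (R : realType) (a b c : R) :
  b - a \isn't a Num.int -> c - b \isn't a Num.int -> c - a \isn't a Num.int ->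
  Esull_nondeg (circle_pi a) (circle_pi b) (circle_pi c) =
  winding (c - a) - winding (b - a) - winding (c - b).
Proof.
move=> ab bc ac; pose m := winding (b - a); pose n := winding (c - b).
have [m1 m2] := winding_itv _ (b - a); have [n1 n2] := winding_itv _ (c - b).
rewrite -/m in m1 m2 *; rewrite -/n in n1 n2 *.
pose u := b - a + (2 * - m)%:~R; pose v := c - b + (2 * - n)%:~R.
have uZ : u \isn't a Num.int by exact: nonintD.
have vZ : v \isn't a Num.int by exact: nonintD.
have uvE : u + v = c - a + (2 * - (m + n))%:~R.
  by rewrite /u /v !intrM !intrN intrD; ring.
have uvZ : u + v \isn't a Num.int by rewrite uvE; exact: nonintD.
have := nonint_neq _ _ (-1) uZ; have := nonint_neq _ _ (-1) vZ.
rewrite mulrN1z => v1 u1.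
have bE : circle_pi b = circle_pi (a + u).
  by apply/circle_piP; exists m; rewrite /u intrM intrN; ring.
have cE : circle_pi c = circle_pi (a + u + v).
  by apply/circle_piP; exists (m + n); rewrite /u /v !intrM !intrN intrD; ring.
rewrite bE cE Esull_nondeg_near //.
- by rewrite uvE intrM windingD; ring.
- rewrite lt_neqAle eq_sym u1 /= /u intrM intrN; apply/andP; split; lra.
- rewrite lt_neqAle eq_sym v1 /= /v intrM intrN; apply/andP; split; lra.
Qed.

(** Each difference is perturbed at most twice. When its later entry moves, the floor is preserved
    directly. When its earlier entry moves, the difference is already non-integral, and preserving
    the floor of its negative suffices. *)
Lemma EsullE (R : realType) (a b c : R) :
  Esull (circle_pi a) (circle_pi b) (circle_pi c) =
  winding (c - a) - winding (b - a) - winding (c - b).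
Proof.
rewrite /Esull.
have [c' -> c'P] := push_lift _ c a b.
have [b' -> b'P] := push_lift _ b a c'.
have [a' -> a'P] := push_lift _ a b' c'.
have [ca fca] := c'P a (mem_head _ _).
have [cb fcb] : c' - b \isn't a Num.int /\
    Num.floor (c' - b) = Num.floor (c - b).
  by apply: c'P; rewrite !inE eqxx orbT.
have [ba fba] := b'P a (mem_head _ _).
have [bc fbc] : b' - c' \isn't a Num.int /\
    Num.floor (b' - c') = Num.floor (b - c').
  by apply: b'P; rewrite !inE eqxx orbT.
have [ab fab] := a'P b' (mem_head _ _).
have [ac fac] : a' - c' \isn't a Num.int /\
    Num.floor (a' - c') = Num.floor (a - c').
  by apply: a'P; rewrite !inE eqxx orbT.
have nonintN (u w : R) : u - w \isn't a Num.int -> w - u \isn't a Num.int.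
  by rewrite -opprB rpredN.
have floor_flip (u w u' w' : R) :
    u - w \isn't a Num.int -> u' - w' \isn't a Num.int ->
    Num.floor (u - w) = Num.floor (u' - w') ->
    Num.floor (w - u) = Num.floor (w' - u').
  by move=> uw uw' E; rewrite -opprB floorN_nonint // E -floorN_nonint // opprB.
rewrite Esull_nondegE; [|exact: nonintN..].
congr (_ - _ - _); apply: eq_winding.
- by rewrite -fca; apply: floor_flip => //; exact: nonintN.
- by rewrite -fba; apply: floor_flip => //; exact: nonintN.
- by rewrite -fcb; apply: floor_flip => //; exact: nonintN.
Qed.

Lemma additive1_int (R : realType) (f : R -> R) :
  (forall t, f (t + 1) = f t + 1) ->
  forall t (n : int), f (t + n%:~R) = f t + n%:~R.
Proof.
move=> f1; have fn (t : R) (m : nat) : f (t + m%:R) = f t + m%:R.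
  elim: m => [|m IH]; first by rewrite !addr0.
  by rewrite -addn1 natrD !addrA f1 IH.
move=> t [] m; first exact: fn.
by apply: (addIr (m.+1%:R)); rewrite NegzE mulrNz -fn !subrK.
Qed.

(** * Lifting homeomorphisms *)

(** An increasing surjection cannot jump: the images under [g] of f x - e and f x + e bound a
    neighbourhood of [x] on which [f] stays within e of f x. *)
Lemma increasing_can_continuous (R : realType) (f g : R -> R) :
  {homo f : s t / s < t} -> cancel g f -> continuous f.
Proof.
move=> fI gK x.
have fMn : {mono f : s t / s < t}.
  by apply: leW_mono; apply: le_mono.
apply/cvgrPdist_lt => e e0.
near=> y.
have : y \in `](g (f x - e)), (g (f x + e))[.
  near: y; apply: near_in_itvoo; rewrite in_itv /=.
  by apply/andP; split; rewrite -fMn gK; lra.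
rewrite in_itv /= => /andP[/fI + /fI]; rewrite !gK => ? ?.
rewrite ltr_norml; apply/andP; split; lra.
Unshelve. all: by end_near. Qed.

Lemma Hbar_pos_oriented (R : realType) (h : Hbar R) (x y z : circle R) :
  pos_oriented [:: h x; h y; h z] <-> pos_oriented [:: x; y; z].
Proof. by have /asboolP[ho _] := valP h; exact: ho. Qed.

Lemma Hbar_antipode (R : realType) (h : Hbar R) (x : circle R) :
  h (antipode x) = antipode (h x).
Proof. by have /asboolP[_ ha] := valP h; exact: ha. Qed.

Lemma Htilde_lt (R : realType) (h : Htilde R) : {homo h : s t / s < t}.
Proof. by have /asboolP[hm _] := valP h. Qed.

Lemma HtildeD1 (R : realType) (h : Htilde R) (t : R) : h (t + 1) = h t + 1.
Proof. by have /asboolP[_ h1] := valP h; exact: h1. Qed.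

Lemma Htilde_le (R : realType) (h : Htilde R) : {mono h : s t / s <= t}.
Proof. exact/le_mono/Htilde_lt. Qed.

Lemma Htilde_ltE (R : realType) (h : Htilde R) : {mono h : s t / s < t}.
Proof. exact/leW_mono/Htilde_le. Qed.

Lemma HtildeD (R : realType) (h : Htilde R) (t : R) (n : int) :
  h (t + n%:~R) = h t + n%:~R.
Proof. exact/additive1_int/HtildeD1. Qed.

Lemma exists_Htilde (R : realType) (f g : R -> R) :
  {homo f : s t / s < t} -> cancel g f -> (forall t, f (t + 1) = f t + 1) ->
  exists h : Htilde R, forall t, h t = f t.
Proof.
move=> fI gK f1.
have fMn : {mono f : s t / s < t} by apply: leW_mono; apply: le_mono.
have fK : cancel f g by apply: (inj_can_sym gK); apply: inc_inj; apply: le_mono.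
have gI : {homo g : s t / s < t} by move=> s t st; rewrite -fMn !gK.
pose k : homeo R := Homeo fK gK (increasing_can_continuous R f g fI gK)
  (increasing_can_continuous R g f gI fK).
have kP : k \in @Htilde_pred R by apply/asboolP.
by exists (MkHtilde kP).
Qed.

Lemma Hbar_int (R : realType) (h : Hbar R) (t c : R) (n : int) :
  h (circle_pi t) = circle_pi c ->
  h (circle_pi (t + n%:~R)) = circle_pi (c + n%:~R).
Proof.
move=> hE.
have [m [->|->]] := int_parity n.
- by rewrite intrM !circle_pi_shift.
- rewrite intrD intrM [_ + 1]addrC !addrA !circle_pi_shift -!antipode_pi.
  by rewrite Hbar_antipode hE.
Qed.

(* The lift sends [n, n + 1[ to [c + n, c + n + 1[, where [c] = h [0] and n is
   an integer; preservation of orientation makes it increasing. *)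
Lemma Hbar_lift (R : realType) (h : Hbar R) : exists ht, covers ht h.
Proof.
have [c hc] := circle_piE _ (h (circle_pi 0)).
have hint (n : int) : h (circle_pi n%:~R) = circle_pi (c + n%:~R).
  by rewrite -[n%:~R in LHS]add0r; exact: Hbar_int.
pose lift t u := [/\ circle_pi u = h (circle_pi t),
  c + (Num.floor t)%:~R <= u & u < c + (Num.floor t)%:~R + 1].
have lift_ex t : exists u, lift t u.
  have [] := (floorP _ t _).1 erefl; rewrite /lift.
  set n := Num.floor t => nt tn.
  move: nt; rewrite le_eqVlt => /orP[/eqP <-|nt].
    by exists (c + n%:~R); rewrite hint lexx ltrDl ltr01.
  (* The point [t] lies on the open arc from [n] to its antipode, so its image lies on the open arc
     from [c + n] to its antipode. *)
  have : pos_oriented [:: circle_pi n%:~R; circle_pi t; circle_pi (n%:~R + 1)].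
    by apply/pos_oriented3P; exists t, (n%:~R + 1); split=> //; split=> //; lra.
  rewrite -(Hbar_pos_oriented _ h) hint -antipode_pi Hbar_antipode hint.
  rewrite antipode_pi => /pos_oriented3P[u [v [uE vE [? ? ?]]]].
  exists u; split=> //; first lra.
  have <- : v = c + n%:~R + 1 by apply: circle_pi_near_inj => //; lra.
  by [].
have [f fP] := choice lift_ex.
have fI : {homo f : s t / s < t}.
  move=> s t st; have [fs1 fs2 fs3] := fP s; have [ft1 ft2 ft3] := fP t.
  have [s1 s2] := (floorP _ s _).1 erefl.
  have [t1 t2] := (floorP _ t _).1 erefl.
  have : Num.floor s <= Num.floor t by apply: le_floor; exact: ltW.
  rewrite le_eqVlt => /orP[/eqP stE|]; last first.
    rewrite -lezD1 -(ler_int R) intrD => ?.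
    lra.
  rewrite -stE in ft2 ft3 t1 t2.
  set n := Num.floor s in s1 s2 fs2 fs3 ft2 ft3 t1 t2 *.
  (* By injectivity of [h] only t = n could be sent to c + n, but n <= s < t. *)
  have tn : f t != c + n%:~R.
    apply/eqP => ftE; have : h (circle_pi t) = h (circle_pi n%:~R).
      by rewrite -ft1 ftE hint.
    move=> /(can_inj (homeo_funK h)) tn.
    have : t = n%:~R by apply: circle_pi_near_inj => //; lra.
    lra.
  have {}tn : c + n%:~R < f t by rewrite lt_neqAle eq_sym tn.
  move: s1; rewrite le_eqVlt => /orP[/eqP nsE|ns].
    suff -> : f s = c + n%:~R by [].
    apply: circle_pi_near_inj; [|lra|lra].
    by rewrite fs1 -nsE hint.
  (* For n < s the triple [n], [s], [t] is positively oriented; lifting its image from c + n places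
     f s before f t. *)
  have : pos_oriented [:: circle_pi n%:~R; circle_pi s; circle_pi t].
    by apply/pos_oriented3P; exists s, t; split=> //; split=> //; lra.
  rewrite -(Hbar_pos_oriented _ h) hint.
  move=> /pos_oriented3P[u [v [uE vE [? ? ?]]]].
  have <- : u = f s by apply: circle_pi_near_inj; [rewrite uE fs1|lra|lra].
  have <- : v = f t by apply: circle_pi_near_inj; [rewrite vE ft1|lra|lra].
  by [].
have f1 t : f (t + 1) = f t + 1.
  have [ft1 ft2 ft3] := fP t; have [gt1] := fP (t + 1).
  have -> : Num.floor (t + 1) = Num.floor t + 1.
    have [? ?] := (floorP _ t _).1 erefl.
    apply/floorP; rewrite intrD; split; lra.
  rewrite intrD => ? ?; apply: circle_pi_near_inj; [|lra|lra].
  by rewrite gt1 (Hbar_int _ h t (f t) 1) // ft1.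
have f_surj y : exists t, f t = y.
  have [s hs] := circle_piE _ (homeo_inv h (circle_pi y)).
  have [fs1 _ _] := fP s.
  move: fs1; rewrite -hs homeo_invK => /esym/circle_piP[n yE].
  exists (s + (2 * n)%:~R); rewrite additive1_int // intrM yE.
  by ring.
have [g gP] := choice f_surj.
have [ht htE] := exists_Htilde _ f g fI gP f1.
by exists ht => t; rewrite htE; have [-> _ _] := fP t.
Qed.

(** Agreement at [s] confines k t and l t to the same half-open interval of length 1, which contains
    at most one lift of a given point. *)
Lemma Htilde_eq_lift (R : realType) (h : Hbar R) (k l : Htilde R) (s : R) :
  covers k h -> covers l h -> k s = l s -> k = l.
Proof.
move=> kh lh kls; apply/val_inj/homeoP => t.
have [t1 t2] := (floorP _ (t - s) _).1 erefl.
set n := Num.floor (t - s) in t1 t2.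
have itv (m : Htilde R) : m s + n%:~R <= m t /\ m t < m s + n%:~R + 1.
  by rewrite -HtildeD -HtildeD1 Htilde_le Htilde_ltE; split; lra.
have [k1 k2] := itv k; have [l1 l2] := itv l; rewrite kls in k1 k2.
apply: circle_pi_near_inj; [|lra|lra].
by rewrite -kh -lh.
Qed.

Lemma covers_mul (R : realType) (g h : Hbar R) (k l : Htilde R) :
  covers k g -> covers l h -> covers (k * l)%g (g * h)%g.
Proof. by move=> kg lh t; rewrite -kg -lh. Qed.

Lemma covers_translate (R : realType) (h : Hbar R) (k : Htilde R) (n : int) :
  covers k h -> exists2 l, covers l h & forall t, l t = k t + 2 * n%:~R.
Proof.
move=> kh; pose f t := k t + 2 * n%:~R.
have [l lE] : exists l : Htilde R, forall t, l t = f t.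
  apply: (exists_Htilde _ f (fun t => homeo_inv k (t - 2 * n%:~R))).
  - by move=> t u tu; rewrite ltrD2r Htilde_ltE.
  - by move=> t; rewrite /f homeo_invK subrK.
  - by move=> t; rewrite /f HtildeD1 addrAC.
by exists l => // t; rewrite lE circle_pi_shift kh.
Qed.

Lemma Hbar_lift_at (R : realType) (h : Hbar R) (s y : R) :
  h (circle_pi s) = circle_pi y -> exists2 k, covers k h & k s = y.
Proof.
have [k kh] := Hbar_lift _ h; rewrite kh => /esym/circle_piP[n yE].
by have [l lh lE] := covers_translate _ _ _ n kh; exists l; rewrite // lE yE.
Qed.

Lemma covers_unique (R : realType) (h : Hbar R) (k l : Htilde R) :
  covers k h -> covers l h -> exists n : int, forall t, k t = l t + 2 * n%:~R.
Proof.
move=> kh lh; have /circle_piP[n kl0] : circle_pi (k 0) = circle_pi (l 0).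
  by rewrite -kh -lh.
have [m mh mE] := covers_translate _ _ _ n lh; exists n => t.
by rewrite (Htilde_eq_lift _ _ _ _ 0 kh mh) ?mE.
Qed.

(** * Invariance of winding, fixed suprema and the cocycle identity *)

(** The value of [winding (t - s)] is decided by comparing [t] with integer translates of [s], and
    [k] preserves order and commutes with these translations. *)
Lemma winding_Htilde (R : realType) (k : Htilde R) (s t : R) :
  winding (k t - k s) = winding (t - s).
Proof.
have /winding_intP[] := erefl (winding (t - s)).
set n := winding _; rewrite lerBrDl ltrBlDl => w1 w2; apply/winding_intP.
by rewrite lerBrDl ltrBlDl -!HtildeD Htilde_le Htilde_ltE.
Qed.

(** An increasing bijection carries the supremum of a set to that of its image, and the image of [L]
    is [L] itself. *)
Lemma Htilde_sup_fixed (R : realType) (k : Htilde R) (L : set R) :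
  L !=set0 -> has_ubound L -> (forall y, L y -> L (k y)) ->
  (forall y, L y -> exists2 z, L z & k z = y) -> k (sup L) = sup L.
Proof.
move=> L0 Lub kL Lk; have supL : has_sup L by [].
apply/eqP; rewrite eq_le; apply/andP; split.
  rewrite -[leRHS](homeo_invK k) Htilde_le; apply: ge_sup => // y /kL Lky.
  by rewrite -(Htilde_le _ k) homeo_invK; exact: ub_le_sup.
apply: ge_sup => // y /Lk[z Lz <-]; rewrite Htilde_le; exact: ub_le_sup.
Qed.

Lemma Esull_Hbar (R : realType) (h : Hbar R) (x y z : circle R) :
  Esull (h x) (h y) (h z) = Esull x y z.
Proof.
have [k kh] := Hbar_lift _ h.
have [a ->] := circle_piE _ x; have [b ->] := circle_piE _ y.
have [c ->] := circle_piE _ z.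
by rewrite !kh !EsullE !winding_Htilde.
Qed.

Lemma normr_Esull_le1 (R : realType) (x y z : circle R) : `|Esull x y z| <= 1.
Proof. by rewrite /Esull /Esull_nondeg; do 2?case: ifP. Qed.

(** On lifts, [EsullE] presents the function, up to sign, as the coboundary of the winding of
    differences, so all terms cancel. *)
Lemma Esull_cocycle (R : realType) (x y z w : circle R) :
  Esull y z w - Esull x z w + Esull x y w - Esull x y z = 0.
Proof.
have [a ->] := circle_piE _ x; have [b ->] := circle_piE _ y.
have [c ->] := circle_piE _ z; have [d ->] := circle_piE _ w.
by rewrite !EsullE; ring.
Qed.

(** * Cochains *)

Implicit Types G H : groupType.

Lemma cochainDE G n (f g : cochain G n) s : (f + g) s = f s + g s.
Proof. by []. Qed.

Lemma cochainNE G n (f : cochain G n) s : (- f) s = - f s.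
Proof. by []. Qed.

Lemma coboundaryD G n (f g : cochain G n) :
  coboundary (f + g) = coboundary f + coboundary g.
Proof.
apply/funext => s; rewrite cochainDE /coboundary -big_split /=.
by apply: eq_bigr => i _; rewrite cochainDE mulrDr.
Qed.

Lemma coboundaryN G n (f : cochain G n) : coboundary (- f) = - coboundary f.
Proof.
apply/funext => s; rewrite cochainNE /coboundary -sumrN.
by apply: eq_bigr => i _; rewrite cochainNE mulrN.
Qed.

Lemma coboundary0 G n : coboundary (0 : cochain G n) = 0.
Proof.
by apply/funext => s; rewrite /coboundary big1 // => i _; rewrite mulr0.
Qed.

Lemma bounded_cochain0 G n : bounded_cochain (0 : cochain G n).
Proof. by split=> //; exists 0. Qed.

Lemma bounded_cochainN G n (f : cochain G n) :
  bounded_cochain f -> bounded_cochain (- f).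
Proof.
move=> [fI [B fB]]; split=> [g s|]; first by congr (- _); exact: fI.
by exists B => s; rewrite normrN; exact: fB.
Qed.

Lemma bounded_cochainD G n (f g : cochain G n) :
  bounded_cochain f -> bounded_cochain g -> bounded_cochain (f + g).
Proof.
move=> [fI [B fB]] [gI [C gC]]; split=> [x s|].
  by congr (_ + _); [exact: fI|exact: gI].
by exists (B + C) => s; apply: (le_trans (ler_normD _ _)); exact: lerD.
Qed.

Lemma bounded_cochain_pullback G H (rho : {multiplicative G -> H}) n
    (f : cochain H n) : bounded_cochain f -> bounded_cochain (pullback rho f).
Proof.
move=> [fI [B fB]]; split=> [g s|]; last by exists B => s; exact: fB.
rewrite /pullback -[RHS](fI (rho g)); congr f.
by apply/funext => i /=; rewrite gmulfM.
Qed.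

Lemma bounded_cocycle_pullback G H (rho : {multiplicative G -> H}) n
    (f : cochain H n) : bounded_cocycle f -> bounded_cocycle (pullback rho f).
Proof.
move=> [fb df]; split; first exact: bounded_cochain_pullback.
apply/funext => s.
exact: (congr1 (fun c : cochain H n.+1 => c (rho \o s)) df).
Qed.

Lemma bounded_coboundaryN G n (f : cochain G n) :
  bounded_coboundary f -> bounded_coboundary (- f).
Proof.
case: n f => [|n] f; first by move=> ->; exact: oppr0.
move=> [b bb ->]; exists (- b); first exact: bounded_cochainN.
by rewrite coboundaryN.
Qed.

Lemma bounded_coboundaryD G n (f g : cochain G n) :
  bounded_coboundary f -> bounded_coboundary g -> bounded_coboundary (f + g).
Proof.
case: n f g => [|n] f g; first by move=> -> ->; exact: addr0.
move=> [b bb ->] [c bc ->]; exists (b + c); first exact: bounded_cochainD.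
by rewrite coboundaryD.
Qed.

Lemma bounded_coboundary0 G n : bounded_coboundary (0 : cochain G n).
Proof.
case: n => // n; exists 0; first exact: bounded_cochain0.
by rewrite coboundary0.
Qed.

Lemma bounded_coboundary_pullback G H (rho : {multiplicative G -> H}) n
    (f : cochain H n) :
  bounded_coboundary f -> bounded_coboundary (pullback rho f).
Proof.
case: n f => [|n] f; first by move=> ->.
move=> [b bb ->]; exists (pullback rho b) => //.
exact: bounded_cochain_pullback.
Qed.

Lemma eq_bclass G n (f g : cochain G n) :
  bounded_cocycle f -> bounded_cocycle g -> bounded_coboundary (g - f) ->
  bclass f = bclass g.
Proof.
move=> fc gc gf; apply/seteqP; split=> k [_ kc kf]; split=> //.
- rewrite -[k - g](_ : (k - f) + - (g - f) = _); last first.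
    by rewrite opprB addrA subrK.
  by apply: bounded_coboundaryD => //; exact: bounded_coboundaryN.
- rewrite -[k - f](_ : (k - g) + (g - f) = _); last by rewrite addrA subrK.
  exact: bounded_coboundaryD.
Qed.

(** A bounded cocycle belongs to its own coset, hence here to that of [f]. *)
Lemma bclass_eqP G n (f g : cochain G n) :
  bounded_cocycle g -> bclass f = bclass g -> bounded_coboundary (g - f).
Proof.
move=> gc fg; have : bclass g g.
  by split=> //; rewrite subrr; exact: bounded_coboundary0.
by rewrite -fg => -[].
Qed.

(** The union over all representatives is a single coset, since cohomologous cocycles have
    cohomologous pullbacks. *)
Lemma bpullback_bclass G H (rho : {multiplicative G -> H}) n (f : cochain H n) :
  bounded_cocycle f -> bpullback rho (bclass f) = bclass (pullback rho f).
Proof.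
move=> fc; apply/seteqP; split=> [k [g [_ gc gf]]|k kf].
  suff -> : bclass (pullback rho f) = bclass (pullback rho g) by [].
  apply: eq_bclass; [exact: bounded_cocycle_pullback..|].
  exact: (bounded_coboundary_pullback _ _ rho _ (g - f)).
exists f => //; split=> //; rewrite subrr; exact: bounded_coboundary0.
Qed.

Lemma coboundary1E G (f : cochain G 1) (s : 'I_3 -> G) :
  coboundary f s = f (s \o lift 0) - f (s \o lift 1) + f (s \o lift 2).
Proof.
rewrite /coboundary !big_ord_recl big_ord0.
have -> : lift ord0 (lift ord0 ord0) = 2 :> 'I_3 by exact: val_inj.
have -> : lift ord0 ord0 = 1 :> 'I_3 by exact: val_inj.
have -> : (-1) ^+ (2%R : 'I_3) = 1 :> int by [].
by rewrite expr0 expr1 !mul1r mulN1r addr0 addrA.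
Qed.

Lemma coboundary2E G (f : cochain G 2) (s : 'I_4 -> G) :
  coboundary f s =
  f (s \o lift 0) - f (s \o lift 1) + f (s \o lift 2) - f (s \o lift 3).
Proof.
rewrite /coboundary !big_ord_recl big_ord0.
have -> : lift ord0 (lift ord0 (lift ord0 ord0)) = 3 :> 'I_4 by exact: val_inj.
have -> : lift ord0 (lift ord0 ord0) = 2 :> 'I_4 by exact: val_inj.
have -> : lift ord0 ord0 = 1 :> 'I_4 by exact: val_inj.
have -> : (-1) ^+ (3%R : 'I_4) = -1 :> int by [].
have -> : (-1) ^+ (2%R : 'I_4) = 1 :> int by [].
by rewrite expr0 expr1 !mul1r !mulN1r addr0 !addrA.
Qed.

(** * The bounded class of the Sullivan cocycle *)

Lemma bounded_cocycle_Esull_at (R : realType) (x : circle R) :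
  bounded_cocycle (Esull_at x).
Proof.
split.
  split=> [g s|]; last by exists 1 => s; exact: normr_Esull_le1.
  exact: (Esull_Hbar _ g (s 0 x) (s 1 x) (s 2 x)).
apply/funext => s; rewrite coboundary2E /Esull_at /=.
(* Reading [s] through natural numbers lets the indices of the faces reduce by computation. *)
pose y k := s (inord k) x.
have yE i : s i x = y (val i) by rewrite /y inord_val.
by rewrite !yE /= /bump /= Esull_cocycle.
Qed.

(* The difference is the coboundary of the cochain comparing how far the lifts
   move the two base points; it is bounded since lifts are within distance one
   of commuting with any translation. *)
Lemma bounded_coboundary_Esull_atB (R : realType) (x y : circle R) :
  bounded_coboundary (Esull_at x - Esull_at y).
Proof.
have [s ->] := circle_piE _ x; have [t ->] := circle_piE _ y.
have [L LP] := choice (Hbar_lift R).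
pose c (p : 'I_2 -> Hbar R) : int :=
  winding (L (p 1) t - L (p 0) t) - winding (L (p 1) s - L (p 0) s).
exists c.
  split=> [g p|].
    (* The lift of a product differs from the product of lifts by an even translation; its
       contribution is the same at [t] and at [s], and cancels in [c]. *)
    have shift i : exists n : int,
        forall u, L (g * p i)%g u = L g (L (p i) u) + 2 * n%:~R.
      apply: (covers_unique _ _ _ (L g * L (p i))%g (LP _)).
      exact: covers_mul.
    have [n0 n0E] := shift 0; have [n1 n1E] := shift 1.
    have E u : winding (L (g * p 1%R)%g u - L (g * p 0%R)%g u) =
        winding (L (p 1) u - L (p 0) u) + (n1 - n0).
      rewrite n0E n1E -[in RHS](winding_Htilde _ (L g)) -windingD.
      congr winding; by rewrite intrB; ring.
    by rewrite /c /= !E; ring.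
  exists 1 => p; rewrite /c.
  have [m1 m2] := (floorP _ (t - s) _).1 erefl.
  set m := Num.floor (t - s) in m1 m2.
  (* Both k t - k s lie in [m, m + 1[, so the two arguments of [winding] in [c] differ by less than
     1, and their windings by at most 1. *)
  have itv (k : Htilde R) : k s + m%:~R <= k t /\ k t < k s + m%:~R + 1.
    by rewrite -HtildeD -HtildeD1 Htilde_le Htilde_ltE; split; lra.
  have [? ?] := itv (L (p 0)); have [? ?] := itv (L (p 1)).
  have [] := winding_itv _ (L (p 1) t - L (p 0) t).
  have [] := winding_itv _ (L (p 1) s - L (p 0) s).
  move: (winding _) (winding _) => v w *.
  have vw : (v - w)%:~R < 2%:~R :> R by rewrite intrB; lra.
  have wv : (w - v)%:~R < 2%:~R :> R by rewrite intrB; lra.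
  rewrite !ltr_int in vw wv; lia.
apply/funext => p; rewrite coboundary1E /c cochainDE cochainNE /Esull_at /=.
rewrite !LP !EsullE.
rewrite [lift 0 0](_ : _ = 1); last exact: val_inj.
rewrite [lift 0 1](_ : _ = 2); last exact: val_inj.
rewrite [lift 1 0](_ : _ = 0); last exact: val_inj.
rewrite [lift 1 1](_ : _ = 2); last exact: val_inj.
rewrite [lift 2 0](_ : _ = 0); last exact: val_inj.
rewrite [lift 2 1](_ : _ = 1); last exact: val_inj.
by ring.
Qed.

Lemma eq_bclass_Esull_at (R : realType) (x y : circle R) :
  bclass (Esull_at x) = bclass (Esull_at y).
Proof.
by apply: eq_bclass; [exact: bounded_cocycle_Esull_at..|
  exact: bounded_coboundary_Esull_atB].
Qed.

(** * Bounded primitives, fixed points and small orbits *)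

Definition pair_fun {T : Type} (x y : T) : 'I_2 -> T :=
  fun i => if i == 0 then x else y.

Definition triple_fun {T : Type} (x y z : T) : 'I_3 -> T :=
  fun i => if i == 0 then x else if i == 1 then y else z.

Lemma coboundary_triple (G : groupType) (f : cochain G 1) (x y z : G) :
  coboundary f (triple_fun x y z) =
  f (pair_fun y z) - f (pair_fun x z) + f (pair_fun x y).
Proof.
rewrite coboundary1E; congr (f _ - f _ + f _);
  by apply/funext => -[[|[|//]] ?].
Qed.

Lemma multiplicative1 (G H : groupType) (f : {multiplicative G -> H}) :
  f 1%g = 1%g.
Proof. by apply: (@mulgI _ (f 1%g)); rewrite -gmulfM !mulg1. Qed.

Lemma lift_fixed_of_bclass0 (R : realType) (Gamma : groupType)
    (rho : {multiplicative Gamma -> Hbar R}) (x : circle R) :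
  bpullback rho (bclass (Esull_at x)) = bclass 0 ->
  exists rhot : {multiplicative Gamma -> Htilde R},
    (forall g, covers (rhot g) (rho g)) /\ exists t : R, forall g, rhot g t = t.
Proof.
have [s ->] := circle_piE _ x.
have Ec := bounded_cocycle_Esull_at _ (circle_pi s).
rewrite bpullback_bclass // => /esym.
move=> /(bclass_eqP _ _ _ _ (bounded_cocycle_pullback _ _ rho _ _ Ec)).
rewrite subr0 => -[b [bI [B bB]] Eb].
(* [beta] is the inhomogeneous form of [b]: invariance turns b(g, gh) into [beta h]. *)
pose beta g := b (pair_fun 1%g g).
have EbE g h :
    Esull (circle_pi s) (rho g (circle_pi s)) (rho (g * h)%g (circle_pi s)) =
    beta h - beta (g * h)%g + beta g.
  have Etri : Esull (rho 1%g (circle_pi s)) (rho g (circle_pi s))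
      (rho (g * h)%g (circle_pi s)) =
      coboundary b (triple_fun 1%g g (g * h)%g).
    by rewrite -Eb.
  rewrite multiplicative1 coboundary_triple in Etri; apply: etrans Etri _.
  congr (_ - _ + _); rewrite /beta -[RHS](bI g); congr b.
  by apply/funext => -[[|[|//]] ?]; rewrite /pair_fun /= ?mulg1.
(* Translating a lift by 2n changes this winding by n, so any prescribed value can be reached. *)
have lift_ex g : exists k, covers k (rho g) /\ winding (k s - s) = - beta g.
  have [k kg] := Hbar_lift _ (rho g).
  have [l lg lE] := covers_translate _ _ _ (- beta g - winding (k s - s)) kg.
  by exists l; split=> //; rewrite lE addrAC windingD; ring.
have [r rP] := choice lift_ex.
have r_cov g : covers (r g) (rho g) by case: (rP g).
have r_wind g : winding (r g s - s) = - beta g by case: (rP g).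
have rM : {morph r : g h / (g * h)%g}.
  move=> g h; have cov : covers (r g * r h)%g (rho (g * h)%g).
    by rewrite gmulfM; exact: covers_mul.
  apply: (Htilde_eq_lift _ _ _ _ s (r_cov _) cov).
  have wind : winding ((r g * r h)%g s - s) = - beta (g * h)%g.
    have := EbE g h; rewrite cov (r_cov g) EsullE r_wind.
    have -> : (r g * r h)%g s = r g (r h s) by [].
    rewrite winding_Htilde r_wind; lia.
  (* The two lifts of the product differ at [s] by 2n, and their equal windings force n = 0. *)
  have /circle_piP[n nE] :
      circle_pi (r (g * h)%g s) = circle_pi ((r g * r h)%g s).
    by rewrite -cov -r_cov.
  have : winding (r (g * h)%g s - s) = winding ((r g * r h)%g s - s) + n.
    by rewrite nE addrAC windingD.
  rewrite r_wind wind => ?; have n0 : n = 0 by lia.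
  by rewrite nE n0 mulr0 addr0.
pose rhot : {multiplicative Gamma -> Htilde R} :=
  HB.pack r (isMultiplicative.Build _ _ r rM).
exists rhot; split=> //; pose L := range (fun g => r g s).
exists (sup L) => g; apply: Htilde_sup_fixed.
- by exists (r 1%g s); exists 1%g.
(* The winding of r h s - s is -beta h, which is at most [B]. *)
- exists (s + 2 * B%:~R + 1) => _ [h _ <-].
  have := bB (pair_fun 1%g h); rewrite -/(beta h) ler_norml => /andP[].
  rewrite lerNl -r_wind -(ler_int R) => hB _.
  have [_ ?] := winding_itv _ (r h s - s); lra.
- by move=> _ [h _ <-]; exists (g * h)%g => //; rewrite rM.
- move=> _ [h _ <-]; exists (r (g^-1 * h)%g s); first by exists (g^-1 * h)%g.
  by rewrite -[in RHS](mulVKg g h) [in RHS]rM.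
Qed.

(** A lift fixing [t] fixes all its integer translates, and so preserves the half-open unit interval
    [t + n, t + n + 1[ that contains [s]. *)
Lemma fixed_orbit_small (R : realType) (Gamma : groupType)
    (rho : Gamma -> Hbar R) (x y : circle R) :
  (forall g, rho g x = x) -> small (range (fun g => rho g y)).
Proof.
have [t ->] := circle_piE _ x; have [s ->] := circle_piE _ y => fix_t.
have [s1 s2] := (floorP _ (s - t) _).1 erefl; set n := Num.floor _ in s1 s2.
exists (t + n%:~R); left=> _ [g _ <-].
have [k kg kt] := Hbar_lift_at _ _ _ _ (fix_t g).
exists (k s); last by rewrite kg.
rewrite /= in_itv /= -{1 2}kt -HtildeD -HtildeD1 Htilde_le Htilde_ltE.
by apply/andP; split; lra.
Qed.

(** Lifts in one half-open unit interval have differences in [-1, 1[, so all three terms of [EsullE]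
    vanish. *)
Lemma small_orbit_Esull_at (R : realType) (Gamma : groupType)
    (rho : Gamma -> Hbar R) (x : circle R) :
  small (range (fun g => rho g x)) -> pullback rho (Esull_at x) = 0.
Proof.
move=> sm.
have [f [fE fd]] : exists f : Gamma -> R,
    (forall g, rho g x = circle_pi (f g)) /\
    forall g h, -1 <= f g - f h < 1.
  case: sm => a [] sm.
  - have ex g : exists u, rho g x = circle_pi u /\ a <= u < a + 1.
      by have [|u /= /[!in_itv]/= ua <-] := sm (rho g x); [exists g|exists u].
    have [f fP] := choice ex; exists f; split=> [g|g h]; first by case: (fP g).
    have [_ /andP[? ?]] := fP g; have [_ /andP[? ?]] := fP h.
    by apply/andP; split; lra.
  - have ex g : exists u, rho g x = circle_pi u /\ a < u <= a + 1.
      by have [|u /= /[!in_itv]/= ua <-] := sm (rho g x); [exists g|exists u].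
    have [f fP] := choice ex; exists f; split=> [g|g h]; first by case: (fP g).
    have [_ /andP[? ?]] := fP g; have [_ /andP[? ?]] := fP h.
    by apply/andP; split; lra.
apply/funext => p; rewrite /pullback /Esull_at /= !fE EsullE.
have w0 g h : winding (f g - f h) = 0.
  by have /andP[? ?] := fd g h; exact: winding_eq0.
by rewrite !w0.
Qed.

Theorem theoremA6 (R : realType) (Gamma : groupType)
    (rho : {multiplicative Gamma -> Hbar R}) :
  (forall x y : circle R,
     bpullback rho (bclass (Esull_at x)) = bpullback rho (bclass (Esull_at y)))
  /\
  forall x0 : circle R,
  [<-> bpullback rho (bclass (Esull_at x0)) = bclass 0;
       exists rhot : {multiplicative Gamma -> Htilde R},
         (forall g, covers (rhot g) (rho g)) /\
         exists t : R, forall g, rhot g t = t;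
       exists x : circle R, forall g, rho g x = x;
       forall x : circle R, small (range (fun g => rho g x));
       exists x : circle R, small (range (fun g => rho g x));
       forall x : circle R, pullback rho (Esull_at x) = 0;
       exists x : circle R, pullback rho (Esull_at x) = 0].
Proof.
split=> [x y|x0]; first by rewrite (eq_bclass_Esull_at _ x y).
have vanish x : pullback rho (Esull_at x) = 0 ->
    bpullback rho (bclass (Esull_at x0)) = bclass 0.
  move=> E0; rewrite (eq_bclass_Esull_at _ x0 x) bpullback_bclass ?E0 //.
  exact: bounded_cocycle_Esull_at.
have fixed (rhot : {multiplicative Gamma -> Htilde R}) (t : R) :
    (forall g, covers (rhot g) (rho g)) -> (forall g, rhot g t = t) ->
    forall g, rho g (circle_pi t) = circle_pi t.
  by move=> cov fix_t g; rewrite cov fix_t.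
tfae.
- exact: lift_fixed_of_bclass0.
- by move=> [rhot [cov [t fix_t]]]; exists (circle_pi t); exact: (fixed rhot).
- by move=> [x fix_x] y; exact: (fixed_orbit_small _ _ _ x).
- by move=> sm; exists x0.
(* One small orbit gives vanishing at one base point, hence a trivial class and a global fixed
   point; then every orbit is small and the cocycle vanishes at every base point. *)
- move=> [x /small_orbit_Esull_at/vanish/lift_fixed_of_bclass0].
  move=> [rhot [cov [t fix_t]]] y.
  exact/small_orbit_Esull_at/fixed_orbit_small/(fixed rhot).
- by move=> E0; exists x0.
- by move=> [x /vanish].
Qed.
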